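(* Consider the one-dimensional semi-discrete finite volume scheme for the Euler equations with gravity described in the context, together with a numerical flux $\hat f$ which satisfies the contact property and reconstruction of the variables $w=[\rho e^{-\psi_h},\,u,\,p e^{-\psi_h}]^\top$. The scheme is well-balanced in the sense that the initial condition given by $$u_i=0,\qquad p_i\exp(-\psi_i)=\text{const}\qquad\text{for all } i,$$ where $\psi_i=\psi_h(x_i)$, is preserved by the numerical scheme (i.e. $\mathrm{d}q_i/\mathrm{d}t=0$ at this state).
   Context: Equations. The 1-D Euler equations with gravity are $\partial_t q+\partial_x f=[0,\,s,\,su]^\top$ with $s=-\rho\,\partial_x\phi$, conserved variables $q=[\rho,\rho u,E]^\top$, flux $f=[\rho u,\;p+\rho u^2,\;(E+p)u]^\top$ and primitive variables $v=[\rho,u,p]^\top$. Here $\rho$ is density, $u$ velocity, $p$ pressure, $E=\rho\varepsilon+\frac12\rho u^2$ with $\varepsilon$ the internal energy per unit mass, and $\phi$ a given gravitational potential. The equation of state is written $p=\rho\theta$, where $\theta$ is a function of the thermodynamic variables, e.g. $\theta=\theta(p,T)$ or $\theta=\theta(\rho,T)$ with $T$ the temperature. Grid. The domain is divided into $N$ finite volumes $(x_{i-1/2},x_{i+1/2})$, each of size $\Delta x$, with centers $x_i=\frac12(x_{i-1/2}+x_{i+1/2})$. Put $\phi_i=\phi(x_i)$ and let $\theta_i=\theta(p_i,T_i)$ be the value of $\theta$ in cell $i$. The function $\psi_h$. Let $\phi_h$ be the continuous piecewise linear interpolant of $\phi$ with nodes $x_i$, so that $\phi_{i+1/2}:=\phi_h(x_{i+1/2})=\frac12(\phi_i+\phi_{i+1})$,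 and let $\theta_h(x)=\theta_i$ for $x\in(x_{i-1/2},x_{i+1/2})$. Define the continuous function $$\psi_h(x)=-\int^x\frac{\phi_h'(s)}{\theta_h(s)}\,\mathrm{d}s,$$ where the lower limit is arbitrary, since only differences of $\psi_h$ are used. Scheme. For the $i$-th cell, $$\frac{\mathrm{d}q_i}{\mathrm{d}t}+\frac{\hat f_{i+\frac12}-\hat f_{i-\frac12}}{\Delta x}=\begin{bmatrix}0\\ s_i\\ s_iu_i\end{bmatrix},\qquad \hat f_{i+\frac12}=\hat f(v^L_{i+\frac12},v^R_{i+\frac12}).$$ Numerical flux. $\hat f$ is consistent: $\hat f(v,v)=f(v)$. Contact property: for any two states $v^L=[\rho^L,0,p]$ and $v^R=[\rho^R,0,p]$ one has $\hat f(v^L,v^R)=[0,\,p,\,0]^\top$. Reconstruction at the face $x_{i+1/2}$. Take $\psi_h$ relative to $x_{i+1/2}$ (so $\psi_h(x_{i+1/2})=0$), put $\psi_j=\psi_h(x_j)$ and $w_j=[\rho_je^{-\psi_j},\,u_j,\,p_je^{-\psi_j}]^\top$ for $j=i-1,i,i+1,i+2$. Using these values, any reconstruction scheme (e.g. the minmod scheme) can be used to obtain $w^L_{i+1/2}$ and $w^R_{i+1/2}$. The primitive face states are $\rho^{L}_{i+1/2}=e^{\psi_{i+1/2}}(w_1)^{L}_{i+1/2}$, $u^{L}_{i+1/2}=(w_2)^{L}_{i+1/2}$, $p^{L}_{i+1/2}=e^{\psi_{i+1/2}}(w_3)^{L}_{i+1/2}$, with $\psi_{i+1/2}=\psi_h(x_{i+1/2})=0$,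 and likewise for $R$. Source term. $$s_i=\frac{\bar p^L_{i+\frac12}-\bar p^R_{i-\frac12}}{\Delta x},\qquad \bar p^L_{i+\frac12}=p_i\exp\left(-\frac{\phi_{i+1}-\phi_i}{2\theta_i}\right),\qquad \bar p^R_{i-\frac12}=p_i\exp\left(\frac{\phi_i-\phi_{i-1}}{2\theta_i}\right).$$ *)

(* Defs.v *)
From Stdlib Require Import Reals Lra Lia ZArith.
From Coquelicot Require Import Coquelicot.
Open Scope R_scope.

(* Common type of conserved states [rho, rho u, E], primitive states
   [rho, u, p], scaled primitive states w and fluxes. *)
Definition vec : Type := (R * R * R)%type.
Definition c1 (w : vec) : R := fst (fst w).
Definition c2 (w : vec) : R := snd (fst w).
Definition c3 (w : vec) : R := snd w.

Definition rho (v : vec) : R := c1 v.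
Definition vel (v : vec) : R := c2 v.
Definition pres (v : vec) : R := c3 v.

(* The internal energy per unit mass and the temperature are functions of
   (rho, p), since [rho, u, p] determines the state.  theta takes rho, p and T
   so as to cover both theta(p, T) and theta(rho, T). *)
Record eos := Eos {
  int_energy : R -> R -> R;
  temperature : R -> R -> R;
  theta : R -> R -> R -> R;
  eos_law : forall r p, 0 < r -> 0 < p -> p = r * theta r p (temperature r p)
}.

Definition energy (M : eos) (v : vec) : R :=
  rho v * int_energy M (rho v) (pres v) + / 2 * rho v * (vel v) ^ 2.

Definition conserved (M : eos) (v : vec) : vec :=
  (rho v, rho v * vel v, energy M v).

Definition euler_flux (M : eos) (v : vec) : vec :=
  (rho v * vel v,
   pres v + rho v * (vel v) ^ 2,
   (energy M v + pres v) * vel v).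

Definition theta_cell (M : eos) (V : Z -> vec) (i : Z) : R :=
  theta M (rho (V i)) (pres (V i)) (temperature M (rho (V i)) (pres (V i))).

(* N cells numbered 1, ..., N of size dx; xleft = x_{1/2}. *)
Record grid := Grid {
  xleft : R;
  dx : R;
  ncells : nat;
  dx_pos : 0 < dx
}.

(* Cells outside 1, ..., N are ghost cells on the continued uniform grid; the
   scheme in cells 1, ..., N reads two of them on each side. *)
Definition interior_cell (G : grid) (i : Z) : Prop :=
  (1 <= i <= Z.of_nat (ncells G))%Z.
Definition stencil_cell (G : grid) (i : Z) : Prop :=
  (-1 <= i <= Z.of_nat (ncells G) + 2)%Z.

(* [xface G i] is x_{i+1/2}. *)
Definition xface (G : grid) (i : Z) : R := xleft G + IZR i * dx G.
Definition xcenter (G : grid) (i : Z) : R :=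
  / 2 * (xface G (i - 1) + xface G i).

Definition phi_cell (G : grid) (phi : R -> R) (i : Z) : R :=
  phi (xcenter G i).

Definition phi_h (G : grid) (phi : R -> R) (x : R) : R :=
  let k := Int_part ((x - xcenter G 0) / dx G) in
  phi_cell G phi k
  + (phi_cell G phi (k + 1) - phi_cell G phi k) * ((x - xcenter G k) / dx G).

(* The values at the faces do not affect the integral below. *)
Definition theta_h (G : grid) (th : Z -> R) (x : R) : R :=
  th (Int_part ((x - xleft G) / dx G) + 1)%Z.

Lemma Int_part_eq (r : R) (k : Z) : IZR k <= r < IZR k + 1 -> Int_part r = k.
Proof.
intros [H1 H2]; symmetry; apply Int_part_spec; lra.
Qed.

Lemma phi_h_linear (G : grid) (phi : R -> R) (i : Z) (x : R) :
  xcenter G i <= x <= xcenter G (i + 1) ->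
  phi_h G phi x =
  phi_cell G phi i
  + (phi_cell G phi (i + 1) - phi_cell G phi i) * ((x - xcenter G i) / dx G).
Proof.
intros [H1 H2]; pose proof (dx_pos G) as Hd.
assert (Hc : forall k, xcenter G k = xleft G + (IZR k - / 2) * dx G).
{ intro k; unfold xcenter, xface; rewrite minus_IZR; field. }
destruct (Rle_lt_or_eq_dec _ _ H2) as [H3 | ->]; unfold phi_h.
- rewrite (Int_part_eq _ i); [reflexivity|].
  rewrite !Hc, plus_IZR in *; split.
  + apply Rle_div_r; lra.
  + apply Rlt_div_l; lra.
- rewrite (Int_part_eq _ (i + 1)).
  + rewrite !Hc, plus_IZR; field; lra.
  + replace ((xcenter G (i + 1) - xcenter G 0) / dx G) with (IZR (i + 1))
      by (rewrite !Hc; field; lra).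
    lra.
Qed.

Lemma theta_h_cell (G : grid) (th : Z -> R) (i : Z) (x : R) :
  xface G (i - 1) < x < xface G i -> theta_h G th x = th i.
Proof.
unfold xface, theta_h; rewrite minus_IZR; intros [H1 H2].
pose proof (dx_pos G) as Hd.
rewrite (Int_part_eq _ (i - 1)); [f_equal; lia|].
rewrite minus_IZR; split.
- apply Rle_div_r; lra.
- apply Rlt_div_l; lra.
Qed.

(* psi_h with lower limit of integration [a]. *)
Definition psi_h (G : grid) (phi : R -> R) (th : Z -> R) (a x : R) : R :=
  - RInt (fun s => Derive (phi_h G phi) s / theta_h G th s) a x.

Definition consistent_flux (M : eos) (fhat : vec -> vec -> vec) : Prop :=
  forall v : vec, fhat v v = euler_flux M v.

Definition contact_property (fhat : vec -> vec -> vec) : Prop :=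
  forall rL rR p : R, fhat (rL, 0, p) (rR, 0, p) = (0, p, 0).

(* A reconstruction at x_{i+1/2} maps the values in cells i-1, i, i+1, i+2 to
   a face value.  What makes it a reconstruction is that a component that is
   constant over the stencil is reproduced exactly; it is not assumed to act
   component by component. *)
Definition reconstruction (rec : vec -> vec -> vec -> vec -> vec) : Prop :=
  forall c : vec -> R, c = c1 \/ c = c2 \/ c = c3 ->
  forall (k : R) (wm w0 w1 w2 : vec),
    c wm = k -> c w0 = k -> c w1 = k -> c w2 = k ->
    c (rec wm w0 w1 w2) = k.

(* w_j, with psi_h taken relative to x_{i+1/2}. *)
Definition w_var (G : grid) (phi : R -> R) (M : eos) (V : Z -> vec)
    (i j : Z) : vec :=
  let psi := psi_h G phi (theta_cell M V) (xface G i) (xcenter G j) in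
  (rho (V j) * exp (- psi), vel (V j), pres (V j) * exp (- psi)).

(* Primitive state at x_{i+1/2}; used for both the L and the R state. *)
Definition face_state (G : grid) (phi : R -> R) (M : eos)
    (rec : vec -> vec -> vec -> vec -> vec) (V : Z -> vec) (i : Z) : vec :=
  let w := rec (w_var G phi M V i (i - 1)) (w_var G phi M V i i)
               (w_var G phi M V i (i + 1)) (w_var G phi M V i (i + 2)) in
  let psi := psi_h G phi (theta_cell M V) (xface G i) (xface G i) in
  (exp psi * c1 w, c2 w, exp psi * c3 w).

(* Numerical flux at x_{i+1/2}. *)
Definition face_flux (G : grid) (phi : R -> R) (M : eos)
    (fhat : vec -> vec -> vec) (recL recR : vec -> vec -> vec -> vec -> vec)
    (V : Z -> vec) (i : Z) : vec :=
  fhat (face_state G phi M recL V i) (face_state G phi M recR V i).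

(* bar p^L_{i+1/2}, bar p^R_{i-1/2} and s_i. *)
Definition pbarL (G : grid) (phi : R -> R) (M : eos) (V : Z -> vec)
    (i : Z) : R :=
  pres (V i) * exp (- ((phi_cell G phi (i + 1) - phi_cell G phi i)
                       / (2 * theta_cell M V i))).
Definition pbarR (G : grid) (phi : R -> R) (M : eos) (V : Z -> vec)
    (i : Z) : R :=
  pres (V i) * exp ((phi_cell G phi i - phi_cell G phi (i - 1))
                    / (2 * theta_cell M V i)).
Definition source (G : grid) (phi : R -> R) (M : eos) (V : Z -> vec)
    (i : Z) : R :=
  (pbarL G phi M V i - pbarR G phi M V i) / dx G.

(* dq_i/dt as prescribed by the scheme at the primitive cell values V. *)
Definition dqdt (G : grid) (phi : R -> R) (M : eos)
    (fhat : vec -> vec -> vec) (recL recR : vec -> vec -> vec -> vec -> vec)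
    (V : Z -> vec) (i : Z) : vec :=
  let s := source G phi M V i in
  minus ((0, s, s * vel (V i)) : vec)
    (scal (/ dx G) (minus (face_flux G phi M fhat recL recR V i)
                          (face_flux G phi M fhat recL recR V (i - 1)))).

Definition scheme_solution (G : grid) (phi : R -> R) (M : eos)
    (fhat : vec -> vec -> vec) (recL recR : vec -> vec -> vec -> vec -> vec)
    (v : R -> Z -> vec) : Prop :=
  forall (t : R) (i : Z), interior_cell G i ->
    is_derive (fun s : R => conserved M (v s i)) t
      (dqdt G phi M fhat recL recR (v t) i).

(* Main.v *)
Require Import Defs.
From Stdlib Require Import Reals ZArith Lra Lia.
From Coquelicot Require Import Coquelicot.
Open Scope R_scope.

(** Put [P = K * exp (psi_h x_{i+1/2})].  Shifting the lower limit of [psi_h]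
    multiplies [p_j * exp (- psi_j)] by a constant independent of [j], so the
    third component of [w] is constant over the stencil of the face and both
    reconstructed pressures equal [P]; by the contact property the flux is
    [(0, P, 0)].  As [psi_h] is linear on each half cell, the exponents in the
    source are the increments of [psi_h] from the cell centre to the faces, so
    that [pbarL] and [pbarR] are the same face pressures [P] and the source
    cancels the flux difference. *)

Lemma xcenter_eq (G : grid) (i : Z) :
  xcenter G i = xleft G + (IZR i - / 2) * dx G.
Proof. unfold xcenter, xface; rewrite minus_IZR; field. Qed.

Lemma Derive_phi_h (G : grid) (phi : R -> R) (i : Z) (x : R) :
  xcenter G i < x < xcenter G (i + 1) ->
  Derive (phi_h G phi) x
  = (phi_cell G phi (i + 1) - phi_cell G phi i) / dx G.
Proof.
intros Hx; pose proof (dx_pos G) as Hd.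
rewrite (Derive_ext_loc _ (fun y => phi_cell G phi i
  + (phi_cell G phi (i + 1) - phi_cell G phi i) * ((y - xcenter G i) / dx G))).
- apply is_derive_unique; auto_derive; [easy | field; lra].
- apply (locally_interval _ x (xcenter G i) (xcenter G (i + 1)));
    [apply Hx | apply Hx |].
  simpl; intros y H1 H2; apply phi_h_linear; lra.
Qed.

(** * Integrability, additivity and half-cell increments of [psi_h] *)

Section Psi.

Variables (G : grid) (phi : R -> R) (th : Z -> R).

Let dpsi (s : R) : R := Derive (phi_h G phi) s / theta_h G th s.
(** Two indices, because the slope of [phi_h] changes at centres and [theta_h] at faces: [i] selects
    the slope, [j] the cell. They agree on the right half of a cell and differ by one on the left
    half. *)
Let halfstep (i j : Z) : R :=
  (phi_cell G phi (i + 1) - phi_cell G phi i) / (2 * th j).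

(* Also valid when [th j = 0], since [/ 0 = 0]. *)
Lemma is_RInt_dpsi_half (i j : Z) (x y : R) :
  y - x = dx G / 2 ->
  xcenter G i <= x -> y <= xcenter G (i + 1) ->
  xface G (j - 1) <= x -> y <= xface G j ->
  is_RInt dpsi x y (halfstep i j).
Proof.
intros Hxy H1 H2 H3 H4; pose proof (dx_pos G) as Hd.
replace (halfstep i j)
  with (scal (y - x)
    ((phi_cell G phi (i + 1) - phi_cell G phi i) / dx G / th j)).
(* Agreement on the open interval suffices, so kinks of [phi_h] and jumps of [theta_h] at the
   endpoints are harmless. *)
- apply (is_RInt_ext (fun _ =>
    (phi_cell G phi (i + 1) - phi_cell G phi i) / dx G / th j)).
  + rewrite Rmin_left, Rmax_right by lra; intros s Hs; unfold dpsi.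
    now rewrite (Derive_phi_h G phi i), (theta_h_cell G th j) by lra.
  + apply (is_RInt_const (V := R_NormedModule)).
- rewrite Hxy; unfold halfstep, scal; simpl; unfold mult; simpl.
  unfold Rdiv; rewrite Rinv_mult.
  generalize (/ th j); intros r; field; lra.
Qed.

Lemma is_RInt_dpsi_right (i : Z) :
  is_RInt dpsi (xcenter G i) (xface G i) (halfstep i i).
Proof.
pose proof (dx_pos G).
apply is_RInt_dpsi_half; rewrite ?xcenter_eq; unfold xface;
  rewrite ?minus_IZR, ?plus_IZR; lra.
Qed.

Lemma is_RInt_dpsi_left (i : Z) :
  is_RInt dpsi (xface G (i - 1)) (xcenter G i) (halfstep (i - 1) i).
Proof.
pose proof (dx_pos G).
apply is_RInt_dpsi_half; rewrite ?xcenter_eq; unfold xface;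
  rewrite ?plus_IZR, ?minus_IZR; lra.
Qed.

Lemma ex_RInt_dpsi_faces (i : Z) (n : nat) :
  ex_RInt dpsi (xface G i) (xface G (i + Z.of_nat n)).
Proof.
induction n as [|n IH].
- rewrite Z.add_0_r; apply ex_RInt_point.
- apply (ex_RInt_Chasles _ _ _ _ IH).
  apply (ex_RInt_Chasles _ _ (xcenter G (i + Z.of_nat (S n)))).
  + eexists; replace (i + Z.of_nat n)%Z with (i + Z.of_nat (S n) - 1)%Z by lia.
    apply is_RInt_dpsi_left.
  + eexists; apply is_RInt_dpsi_right.
Qed.

(** Any interval lies between two faces, where integrability is known, and integrability passes to
    subintervals. *)
Lemma ex_RInt_dpsi (x y : R) : ex_RInt dpsi x y.
Proof.
assert (Hle : forall u v, u <= v -> ex_RInt dpsi u v).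
{ intros u v Huv; pose proof (dx_pos G) as Hd.
  set (m := Int_part ((u - xleft G) / dx G)).
  set (k := up ((v - xleft G) / dx G)).
  assert (Hm : xface G m <= u).
  { unfold xface; destruct (base_Int_part ((u - xleft G) / dx G)) as [H _].
    apply (Rle_div_r _ _ _ Hd) in H; fold m in H; lra. }
  assert (Hk : v <= xface G k).
  { unfold xface; destruct (archimed ((v - xleft G) / dx G)) as [H _].
    apply Rgt_lt, (Rlt_div_l _ _ _ Hd) in H; fold k in H; lra. }
  assert (Hmk : (m <= k)%Z).
  { apply le_IZR, (Rmult_le_reg_r (dx G)); [exact Hd|].
    unfold xface in *; lra. }
  assert (H : ex_RInt dpsi (xface G m) (xface G k)).
  { replace k with (m + Z.of_nat (Z.to_nat (k - m)))%Z by lia.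
    apply ex_RInt_dpsi_faces. }
  apply (ex_RInt_Chasles_2 (V := R_CompleteNormedModule) _ (xface G m));
    [lra|].
  apply (ex_RInt_Chasles_1 (V := R_CompleteNormedModule) _ _ _ (xface G k));
    [lra | exact H]. }
destruct (Rle_dec x y).
- now apply Hle.
- apply ex_RInt_swap, Hle; lra.
Qed.

(** Links the lower limit [a] of the equilibrium condition to the face-based one used in [w_var]. *)
Lemma psi_h_Chasles (a b x : R) :
  psi_h G phi th a b + psi_h G phi th b x = psi_h G phi th a x.
Proof.
unfold psi_h; fold dpsi.
rewrite <- (RInt_Chasles dpsi a b x) by apply ex_RInt_dpsi.
unfold plus; simpl; ring.
Qed.

Lemma psi_h_face_right (a : R) (i : Z) :
  psi_h G phi th a (xface G i)
  = psi_h G phi th a (xcenter G i)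
    - (phi_cell G phi (i + 1) - phi_cell G phi i) / (2 * th i).
Proof.
rewrite <- (psi_h_Chasles a (xcenter G i) (xface G i)).
unfold psi_h at 2; fold dpsi.
now rewrite (is_RInt_unique _ _ _ _ (is_RInt_dpsi_right i)).
Qed.

Lemma psi_h_face_left (a : R) (i : Z) :
  psi_h G phi th a (xface G (i - 1))
  = psi_h G phi th a (xcenter G i)
    + (phi_cell G phi i - phi_cell G phi (i - 1)) / (2 * th i).
Proof.
rewrite <- (psi_h_Chasles a (xface G (i - 1)) (xcenter G i)).
unfold psi_h at 3; fold dpsi.
rewrite (is_RInt_unique _ _ _ _ (is_RInt_dpsi_left i)).
unfold halfstep; replace (i - 1 + 1)%Z with i by lia; ring.
Qed.

End Psi.

(** * Fluxes and source at the equilibrium state *)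

Section Equilibrium.

Variables (G : grid) (phi : R -> R) (M : eos) (V : Z -> vec) (a K : R).

Let psi (x : R) : R := psi_h G phi (theta_cell M V) a x.
Let equilibrium_cell (i : Z) : Prop :=
  vel (V i) = 0 /\ pres (V i) * exp (- psi (xcenter G i)) = K.

Lemma pres_equilibrium (i : Z) (x : R) :
  equilibrium_cell i ->
  pres (V i) * exp (psi x - psi (xcenter G i)) = K * exp (psi x).
Proof.
intros [_ <-]; unfold Rminus; rewrite exp_plus; ring.
Qed.

(** The value is free of [j], which is what lets a reconstruction reproduce it. *)
Lemma w_var_pres (i j : Z) :
  equilibrium_cell j ->
  c3 (w_var G phi M V i j) = K * exp (psi (xface G i)).
Proof.
intros Hj; rewrite <- (pres_equilibrium j _ Hj); unfold w_var, c3, psi; simpl.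
rewrite <- (psi_h_Chasles _ _ _ a (xface G i) (xcenter G j)).
do 2 f_equal; ring.
Qed.

(** The density stays existential: its scaled values may vary over the stencil, and the contact
    property admits any face densities. *)
Lemma face_state_equilibrium rec (i : Z) :
  reconstruction rec ->
  (forall j, (i - 1 <= j <= i + 2)%Z -> equilibrium_cell j) ->
  exists r, face_state G phi M rec V i = (r, 0, K * exp (psi (xface G i))).
Proof.
intros Hrec Heq; unfold face_state.
replace (psi_h G phi (theta_cell M V) (xface G i) (xface G i)) with 0.
2: { unfold psi_h; rewrite RInt_point; unfold zero; simpl; ring. }
eexists; cbv zeta; rewrite exp_0, !Rmult_1_l; f_equal; [f_equal|].
- apply Hrec; [now right; left | ..]; unfold w_var, c2; simpl;
    apply Heq; lia.
- apply Hrec; [now right; right | ..]; apply w_var_pres, Heq; lia.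
Qed.

Lemma face_flux_equilibrium fhat recL recR (i : Z) :
  contact_property fhat -> reconstruction recL -> reconstruction recR ->
  (forall j, (i - 1 <= j <= i + 2)%Z -> equilibrium_cell j) ->
  face_flux G phi M fhat recL recR V i = (0, K * exp (psi (xface G i)), 0).
Proof.
intros Hcontact HL HR Heq; unfold face_flux.
destruct (face_state_equilibrium recL i HL Heq) as [rL ->].
destruct (face_state_equilibrium recR i HR Heq) as [rR ->].
apply Hcontact.
Qed.

Lemma source_equilibrium (i : Z) :
  equilibrium_cell i ->
  source G phi M V i
  = (K * exp (psi (xface G i)) - K * exp (psi (xface G (i - 1)))) / dx G.
Proof.
intros Hi; unfold source, pbarL, pbarR.
rewrite <- !(pres_equilibrium i _ Hi); unfold psi.
rewrite psi_h_face_right, psi_h_face_left.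
f_equal; f_equal; do 2 f_equal; ring.
Qed.

Lemma dqdt_equilibrium fhat recL recR (i : Z) :
  contact_property fhat -> reconstruction recL -> reconstruction recR ->
  (forall j, (i - 2 <= j <= i + 2)%Z -> equilibrium_cell j) ->
  dqdt G phi M fhat recL recR V i = (0, 0, 0).
Proof.
intros Hcontact HL HR Heq; pose proof (dx_pos G) as Hd; unfold dqdt.
(* The stencils of the faces [i] and [i - 1] together cover the cells [i - 2] to [i + 2]. *)
rewrite !face_flux_equilibrium by (assumption || intros; apply Heq; lia).
rewrite source_equilibrium by (apply Heq; lia).
destruct (Heq i) as [-> _]; [lia|].
unfold minus, plus, opp, scal; simpl.
(* One round of unfolding per level of the nested pair [vec]. *)
unfold prod_plus, prod_opp, prod_scal, plus, opp, scal; simpl.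
unfold prod_plus, prod_opp, prod_scal, plus, opp, scal; simpl.
unfold mult; simpl.
f_equal; [f_equal|]; field; lra.
Qed.

End Equilibrium.

Theorem theorem2 (G : grid) (phi : R -> R) (M : eos)
    (fhat : vec -> vec -> vec)
    (recL recR : vec -> vec -> vec -> vec -> vec)
    (Hconsistent : consistent_flux M fhat)
    (Hcontact : contact_property fhat)
    (HrecL : reconstruction recL) (HrecR : reconstruction recR)
    (V : Z -> vec)
    (Hpos : forall i : Z, stencil_cell G i -> 0 < rho (V i) /\ 0 < pres (V i))
    (a K : R)
    (Hu : forall i : Z, stencil_cell G i -> vel (V i) = 0)
    (Hp : forall i : Z, stencil_cell G i ->
       pres (V i)
       * exp (- psi_h G phi (theta_cell M V) a (xcenter G i)) = K) :
  (forall i : Z, interior_cell G i ->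
     dqdt G phi M fhat recL recR V i = (0, 0, 0))
  /\ scheme_solution G phi M fhat recL recR (fun _ : R => V).
Proof.
assert (H : forall i : Z, interior_cell G i ->
  dqdt G phi M fhat recL recR V i = (0, 0, 0)).
{ intros i Hi; apply (dqdt_equilibrium _ _ _ _ a K); try assumption.
  intros j Hj.
  assert (Hs : stencil_cell G j)
    by (unfold interior_cell, stencil_cell in *; lia).
  split; [apply (Hu j Hs) | apply (Hp j Hs)]. }
split; [exact H|].
(* The zero of the product space is [(0, 0, 0)], so the constant state solves the scheme. *)
intros t i Hi; rewrite (H i Hi); apply (is_derive_const (conserved M (V i))).
Qed.
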